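(* Let $(\mathfrak g,[-,-],R)$ be a Rota-Baxter Lie algebra of weight $1$ over $\mathbf k$, let $\mathfrak g^{(p)}=\mathrm{span}_{\mathbf k}\{x^{p^k}\in\mathrm U(\mathfrak g)\mid x\in\mathfrak g,\ k\ge0\}$ be the Lie algebra of primitive elements of $\mathrm U(\mathfrak g)$, and let $R$ also denote the restriction to $\mathfrak g^{(p)}$ of the extension of $R$ to $\mathrm U(\mathfrak g)$, so that $(\mathfrak g^{(p)},[-,-],(-)^p,R)$ is a restricted Rota-Baxter Lie algebra of weight $1$. Then for all $x\in\mathfrak g^{(p)}$, $$R(x^p)=R(x)^p+\sum_{r=1}^{p-1}(-1)^{p-r}\frac1r\sum_{\alpha\vDash p,\ \ell(\alpha)=r}C_\alpha\,[R(x^{\blacktriangleright_R\alpha_1}),[\cdots[R(x^{\blacktriangleright_R\alpha_{r-1}}),R(x^{\blacktriangleright_R\alpha_r})]\cdots]],$$ where $x^{\blacktriangleright_Rk}$ is the sum of all $(k-1)!$ iterated products of $k$ copies of $x$ (counting multiplicities) with respect to $x\rhd_Ry:=[R(x),y]$.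
   Context: Convention: $\mathbf k$ is an algebraically closed field of prime characteristic $p$; everything is over $\mathbf k$. Rota-Baxter Lie algebra of weight $1$: a Lie algebra with a linear map $R$ such that $[R(x),R(y)]=R([R(x),y])+R([x,R(y)])+R([x,y])$ for all $x,y$. Extension to $\mathrm U(\mathfrak g)$ (Goncharov): a Rota-Baxter operator $R$ of weight $1$ on $\mathfrak g$ extends to a well-defined linear map $R:\mathrm U(\mathfrak g)\to\mathrm U(\mathfrak g)$ determined by $R(1)=1$ and $R(xy)=R(x)R(y)-R([R(x),y])$ for $x\in\mathfrak g$, $y\in\mathrm U(\mathfrak g)$ (commutator in $\mathrm U(\mathfrak g)$). It is a coalgebra endomorphism (elements of $\mathfrak g$ primitive), hence preserves $\mathfrak g^{(p)}$, and satisfies $R(x)R(y)=R(x_1R(x_2)\,y\,S(R(x_3)))$ for all $x,y\in\mathrm U(\mathfrak g)$ (Sweedler notation, $S$ the antipode). Brackets and $p$-th powers are taken in $\mathrm U(\mathfrak g)$. For a composition $\alpha=(\alpha_1,\dots,\alpha_r)\vDash n$ (a tuple of positive integers with sum $n$, of length $\ell(\alpha)=r$), $C_\alpha=\prod_{k=1}^r\binom{\alpha_1+\cdots+\alpha_k-1}{\alpha_k-1}$. $\frac1r$ is the inverse of $r$ modulo $p$; for $r=1$ the iterated bracket is just $R(x^{\blacktriangleright_R p})$. The multiplicities in $x^{\blacktriangleright_Rk}$ are given by the recursion $x^{\blacktriangleright_R1}=x$ and $x^{\blacktriangleright_Rk}=\sum_{i=1}^{k-1}\binom{k-2}{i-1}\,x^{\blacktriangleright_Ri}\rhd_Rx^{\blacktriangleright_R(k-i)}$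 for $k\ge2$; e.g. (writing $\rhd$ for $\rhd_R$) $x^{\blacktriangleright_R4}=x\rhd(x\rhd(x\rhd x))+x\rhd((x\rhd x)\rhd x)+2(x\rhd x)\rhd(x\rhd x)+(x\rhd(x\rhd x))\rhd x+((x\rhd x)\rhd x)\rhd x$. *)

(* Defs.v *)
From HB Require Import structures.
From mathcomp Require Import all_boot all_order all_algebra.

Set Implicit Arguments.
Unset Strict Implicit.
Unset Printing Implicit Defensive.

Import GRing.Theory.
Local Open Scope ring_scope.

HB.mixin Record isLieAlgebra (K : fieldType) L of GRing.Lmodule K L := {
  lie : L -> L -> L;
  lie_linearl : forall (a : K) (x y z : L), lie (a *: x + y) z = a *: lie x z + lie y z;
  lie_linearr : forall (a : K) (x y z : L), lie x (a *: y + z) = a *: lie x y + lie x z;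
  liexx : forall x : L, lie x x = 0;
  lie_jacobi : forall x y z : L,
    lie x (lie y z) + lie y (lie z x) + lie z (lie x y) = 0
}.

#[short(type="lieAlgType")]
HB.structure Definition LieAlgebra (K : fieldType) :=
  {L of GRing.Lmodule K L & isLieAlgebra K L}.

Definition rota_baxter1 (K : fieldType) (g : lieAlgType K) (R : g -> g) : Prop :=
  forall x y : g,
    lie (R x) (R y) = R (lie (R x) y) + R (lie x (R y)) + R (lie x y).

Definition commr (A : pzRingType) (a b : A) : A := a * b - b * a.

Definition lie_to_assoc (K : fieldType) (g : lieAlgType K) (A : algType K)
    (f : g -> A) : Prop :=
  forall x y : g, f (lie x y) = commr (f x) (f y).

(* (U, iota) is the universal enveloping algebra of g, by its universal
   property. Algebras in an [algType] satisfy 1 != 0; the zero algebra may be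
   left out as a target because there the property holds trivially. *)
Definition is_universal_enveloping (K : fieldType) (g : lieAlgType K)
    (U : algType K) (iota : {linear g -> U}) : Prop :=
  lie_to_assoc iota /\
  forall (A : algType K) (f : {linear g -> A}), lie_to_assoc f ->
    (exists F : {lrmorphism U -> A}, forall x, F (iota x) = f x) /\
    (forall F F' : {lrmorphism U -> A},
       (forall x, F (iota x) = f x) -> (forall x, F' (iota x) = f x) ->
       forall u, F u = F' u).

(* Goncharov's extension of R to U(g); these equations determine Rhat on every
   product of elements of g, by induction on the number of factors. *)
Definition is_RB_extension (K : fieldType) (g : lieAlgType K) (U : algType K)
    (iota : g -> U) (R : g -> g) (Rhat : U -> U) : Prop :=
  [/\ Rhat 1 = 1,
      forall x : g, Rhat (iota x) = iota (R x)
    & forall (x : g) (y : U),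
        Rhat (iota x * y) =
          Rhat (iota x) * Rhat y - Rhat (commr (Rhat (iota x)) y)].

(* u lies in g^(p), the span of the x^(p^k) for x in g and k >= 0. *)
Definition in_p_closure (K : fieldType) (g : lieAlgType K) (U : algType K)
    (iota : g -> U) (p : nat) (u : U) : Prop :=
  exists (n : nat) (c : 'I_n -> K) (x : 'I_n -> g) (e : 'I_n -> nat),
    u = \sum_(i < n) c i *: iota (x i) ^+ (p ^ e i).

(* [bpow op x k] is the sum of the (k-1)! iterated op-products of k copies of
   x; it is characterized by bpow1 and bpow_rec below, and is junk at k = 0. *)
Fixpoint bpow_fuel (V : nmodType) (op : V -> V -> V) (x : V) (fuel k : nat) : V :=
  if fuel is f.+1 then
    if (k <= 1)%N then x else
    \sum_(1 <= i < k)
      op (bpow_fuel op x f i) (bpow_fuel op x f (k - i)) *+ 'C(k - 2, i - 1)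
  else 0.

Definition bpow (V : nmodType) (op : V -> V -> V) (x : V) (k : nat) : V :=
  bpow_fuel op x k k.

Lemma bpow_fuel_ge (V : nmodType) (op : V -> V -> V) (x : V) (f k : nat) :
  (0 < k <= f)%N -> bpow_fuel op x f k = bpow op x k.
Proof.
rewrite /bpow; elim/ltn_ind: k f => k IH [|f] /andP[k_gt0 le_kf].
  by rewrite leqNgt k_gt0 in le_kf.
case: k IH k_gt0 le_kf => // k IH _ le_kf /=; case: ifP => // _.
apply: eq_big_nat => i /andP[i_gt0 lt_ik].
have Hj : (0 < k.+1 - i <= k)%N.
  by rewrite subn_gt0 lt_ik -ltnS ltn_subrL i_gt0.
have /andP[j_gt0 le_jk] := Hj; have le_ik : (i <= k)%N by rewrite -ltnS.
have bound f' m : (k <= f')%N -> (0 < m <= k)%N ->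
    bpow_fuel op x f' m = bpow_fuel op x m m.
  move=> le_kf' /andP[m_gt0 le_mk]; apply: IH; first by rewrite ltnS.
  by rewrite m_gt0 (leq_trans le_mk).
by rewrite !bound // i_gt0.
Qed.

Lemma bpow1 (V : nmodType) (op : V -> V -> V) (x : V) : bpow op x 1 = x.
Proof. by []. Qed.

Lemma bpow_rec (V : nmodType) (op : V -> V -> V) (x : V) (k : nat) :
  (2 <= k)%N ->
  bpow op x k =
    \sum_(1 <= i < k) op (bpow op x i) (bpow op x (k - i)) *+ 'C(k - 2, i - 1).
Proof.
case: k => // k k_ge2; rewrite {1}/bpow /= leqNgt k_ge2 /=.
apply: eq_big_nat => i /andP[i_gt0 lt_ik].
have le_ik : (i <= k)%N by rewrite -ltnS.
have le_jk : (k.+1 - i <= k)%N by rewrite -ltnS ltn_subrL i_gt0.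
by rewrite !bpow_fuel_ge ?i_gt0 ?le_ik ?subn_gt0 ?lt_ik.
Qed.

Definition rb_tri (U : pzRingType) (Rhat : U -> U) (x y : U) : U :=
  commr (Rhat x) y.

Definition is_composition (n : nat) (a : seq nat) : bool :=
  (0%N \notin a) && (sumn a == n).

Definition comp_coef (a : seq nat) : nat :=
  (\prod_(k < size a) 'C(sumn (take k.+1 a) - 1, nth 0 a k - 1))%N.

Fixpoint nested_commr (A : pzRingType) (s : seq A) : A :=
  match s with
  | [::] => 0
  | [:: u] => u
  | u :: s' => commr u (nested_commr s')
  end.

(* Parts of a composition of n are at most n, so those of length r are among
   the r-tuples over 'I_n.+1. *)
Definition parts (n r : nat) (a : r.-tuple 'I_n.+1) : seq nat :=
  [seq val i | i <- a].

(* Main.v *)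
Require Import Defs.
From mathcomp Require Import all_boot all_order all_algebra.

(** Put y_k = x^(|> k), s_k = (-1)^(k-1) y_k and b_k = R(s_k), and form the
    exponential generating series s(t), b(t) of these sequences. The recursion
    for y_k says s' = -[b, s].
    Let P(t) be the series of operators with P' = P ad(b), P(0) = 1. It is
    multiplicative, P(s) is the constant x, and hence e^(tx) P(t) is the series
    of operators W with W' = W (s + ad b), W(0) = 1. As R(u)R(v) =
    R(uv + [R(u), v]) for primitive u, applying R to W(1) = e^(tx) gives
    B' = B b for B(t) = R(e^(tx)), i.e. R(x^n) = \sum_a C_a b_(a_1)...b_(a_r)
    over the compositions a of n.
    If N(t) is the same sum with nested brackets instead of products, and E is
    the derivation multiplying a word by its length, then E(B) = N B (Dynkin).
    In degree p every mixed term of the product N B has a binomial coefficient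
    divisible by p, so r times the part of length r of R(x^p) is its bracketed
    version; the word of length p is R(x)^p.
    The identity R(u)R(v) = R(uv + [R(u), v]) passes from x to x^p, because
    W_p(v) = x^p v + P_p(v) and P_p = ad(B_p) = ad(R(x^p)); no coproduct on
    U(g) is needed. *)

Import GRing.Theory.
Local Open Scope ring_scope.

(** * Binomial convolution and Bell sums *)

Section BinomialConvolution.
Variable V : zmodType.
Implicit Types (F G : nat -> nat -> V) (n : nat).

(** The n-th coefficient of a product of two exponential generating series, encoded by the Leibniz
    rule: identities between series are proved by differentiating, and binomials appear only through
    [bconvE]. *)
Fixpoint bconv F n : V :=
  if n is m.+1 then
    bconv (fun i j => F i.+1 j) m + bconv (fun i j => F i j.+1) m
  else F 0 0.

Lemma eq_bconv F G n :
  (forall i j, (i + j)%N = n -> F i j = G i j) -> bconv F n = bconv G n.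
Proof.
elim: n F G => [|n IH] F G eqFG /=; first exact: eqFG.
by congr (_ + _); apply: IH => i j ij; apply: eqFG; rewrite -ij ?addnS.
Qed.

Lemma bconvD F G n : bconv (fun i j => F i j + G i j) n = bconv F n + bconv G n.
Proof. by elim: n F G => [|n IH] F G //=; rewrite !IH addrACA. Qed.

Lemma bconv0 n : bconv (fun _ _ => 0) n = 0.
Proof. by elim: n => //= n ->; rewrite addr0. Qed.

Lemma bconvC F n : bconv F n = bconv (fun i j => F j i) n.
Proof. by elim: n F => //= n IH F; rewrite addrC IH [in RHS]addrC addrC IH. Qed.

Lemma bconv_left F n :
  (forall i j, F i.+1 j = 0) -> bconv F n = F 0 n.
Proof.
elim: n F => //= n IH F F0.
rewrite (@eq_bconv (fun i j => F i.+1 j) (fun _ _ => 0)) => [|i j _]; last first.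
  exact: F0.
by rewrite bconv0 add0r IH.
Qed.

Lemma bconv_right F n :
  (forall i j, F i j.+1 = 0) -> bconv F n = F n 0.
Proof. by move=> F0; rewrite bconvC bconv_left. Qed.

Lemma bconvA (F : nat -> nat -> nat -> V) n :
  bconv (fun i j => bconv (F i) j) n =
  bconv (fun i j => bconv (fun a b => F a b j) i) n.
Proof.
elim: n F => //= n IH F; rewrite !bconvD.
rewrite (IH (fun a => F a.+1)) (IH (fun a b => F a b.+1)).
by rewrite (IH (fun a b c => F a b c.+1)) addrA.
Qed.

Lemma bconvAC (F : nat -> nat -> nat -> V) n :
  bconv (fun i j => bconv (fun a b => F a b j) i) n =
  bconv (fun i j => bconv (fun a b => F a j b) i) n.
Proof.
elim: n F => //= n IH F; rewrite !bconvD.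
rewrite (IH (fun a => F a.+1)) (IH (fun a b => F a b.+1)).
by rewrite (IH (fun a b c => F a b c.+1)) addrAC.
Qed.

Lemma bconvE F n : bconv F n = \sum_(i < n.+1) F i (n - i)%N *+ 'C(n, i).
Proof.
elim: n F => [|n IH] F /=; first by rewrite big_ord_recl big_ord0 addr0.
rewrite !IH [RHS]big_ord_recl /= bin0 subn0 mulr1n.
have -> : \sum_(i < n.+1)
    F (bump 0 i) (n.+1 - bump 0 i)%N *+ 'C(n.+1, bump 0 i) =
  \sum_(i < n.+1) F i.+1 (n - i)%N *+ 'C(n, i.+1) +
  \sum_(i < n.+1) F i.+1 (n - i)%N *+ 'C(n, i).
  by rewrite -big_split; apply: eq_bigr => i _; rewrite /bump /= binS mulrnDr.
rewrite addrA [LHS]addrC; congr (_ + _).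
rewrite [LHS]big_ord_recl big_ord_recr /= bin0 subn0.
rewrite (@bin_small n n.+1) // addr0.
congr (_ + _); apply: eq_bigr => i _; rewrite /bump /= add1n.
by rewrite subnSK.
Qed.

Lemma bconv_prime F p : prime p -> (forall v : V, v *+ p = 0) ->
  bconv F p = F 0 p + F p 0.
Proof.
move=> p_pr pV; rewrite bconvE; case: p p_pr pV => // p p_pr pV.
rewrite big_ord_recl big_ord_recr /= bin0 binn subn0 subnn !mulr1n.
rewrite big1 ?add0r // => i _.
have /dvdnP[q ->] : (p.+1 %| 'C(p.+1, bump 0 i))%N.
  by rewrite prime_dvd_bin // /bump /= ltnS ltn_ord.
by rewrite mulrnA pV.
Qed.

End BinomialConvolution.

Arguments bconv {V}.

Lemma morph_bconv (V W : zmodType) (f : V -> W) F n :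
  {morph f : u v / u + v} -> f (bconv F n) = bconv (fun i j => f (F i j)) n.
Proof. by move=> fD; elim: n F => //= n IH F; rewrite fD !IH. Qed.

Lemma mulr_bconvr (A : pzRingType) (c : A) F n :
  c * bconv F n = bconv (fun i j => c * F i j) n.
Proof. by apply: morph_bconv; exact: mulrDr. Qed.

Lemma mulr_bconvl (A : pzRingType) (c : A) F n :
  bconv F n * c = bconv (fun i j => F i j * c) n.
Proof. by apply: (@morph_bconv _ _ (fun u => u * c)) => u v; exact: mulrDl. Qed.

Lemma sumn_incr_nth s i : sumn (incr_nth s i) = (sumn s).+1.
Proof.
elim: s i => [|a s IH] [|i] //=; last by rewrite IH addnS.
by rewrite sumn_ncons mul0n.
Qed.

Section Bell.
Variable V : zmodType.
Implicit Types (Phi Psi : seq nat -> V) (n : nat).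

(* [bell Phi n] is the sum over the compositions a of n of
   C_a Phi [:: a_1 - 1; ...; a_r - 1]. One step of the recursion prepends a part
   equal to 1 or increments a part: this is B_(n+1) = b_1 B_n + d B_n for the
   derivation d sending b_k to b_(k+1). *)
Definition bell_step Phi (s : seq nat) : V :=
  Phi (0%N :: s) + \sum_(i < size s) Phi (incr_nth s i).

Fixpoint bell Phi n : V :=
  if n is m.+1 then bell (bell_step Phi) m else Phi [::].

Lemma eq_bell Phi Psi n :
  (forall s, (sumn s + size s)%N = n -> Phi s = Psi s) ->
  bell Phi n = bell Psi n.
Proof.
elim: n Phi Psi => [|n IH] Phi Psi eqP /=; first exact: eqP.
apply: IH => s sn; congr (_ + _); first by rewrite eqP //= add0n addnS sn.
apply: eq_bigr => i _; apply: eqP.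
by rewrite sumn_incr_nth size_incr_nth ltn_ord -sn addSn.
Qed.

Lemma bellD Phi Psi n :
  bell (fun s => Phi s + Psi s) n = bell Phi n + bell Psi n.
Proof.
elim: n Phi Psi => [|n IH] Phi Psi //=; rewrite -IH.
by apply: eq_bell => s _; rewrite /bell_step big_split addrACA.
Qed.

Lemma bell0 n : bell (fun _ => 0) n = 0.
Proof.
elim: n => //= n {2}<-; apply: eq_bell => s _.
by rewrite /bell_step big1 ?addr0.
Qed.

Lemma bell_sum (I : Type) (r : seq I) (P : pred I) (Phi : I -> seq nat -> V) n :
  bell (fun s => \sum_(i <- r | P i) Phi i s) n =
  \sum_(i <- r | P i) bell (Phi i) n.
Proof.
elim: r => [|i r IH].
  by rewrite big_nil -[RHS](bell0 n); apply: eq_bell => s _; rewrite big_nil.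
rewrite big_cons -IH; case: ifP => Pi; last first.
  by apply: eq_bell => s _; rewrite big_cons Pi.
by rewrite -bellD; apply: eq_bell => s _; rewrite big_cons Pi.
Qed.

(** This is B' = B b, whereas the definition unfolds to B' = b_1 B + d B. Here the last part is
    split off, and its factor of C_a becomes the binomial of the convolution. *)
Lemma bellS Phi n :
  bell Phi n.+1 = bconv (fun i k => bell (fun s => Phi (rcons s k)) i) n.
Proof.
elim: n Phi => [|n IH] Phi; first by rewrite /= /bell_step big_ord0 addr0.
rewrite -[LHS]/(bell (bell_step Phi) n.+1) IH [RHS]/= -bconvD.
apply: eq_bconv => i k _; rewrite -bellD; apply: eq_bell => s _.
(* Incrementing the last part shifts [k]; every other term is the step on [s]. These are the two
   halves of the Leibniz rule. *)
rewrite /bell_step size_rcons big_ord_recr /= addrA.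
congr (_ + _ + _).
  apply: eq_bigr => j _; congr Phi.
  case: j => j /=; elim: s j => [|a s IHs] [|l] //= ls.
  by rewrite IHs.
by congr Phi; elim: s => //= a s ->.
Qed.

Lemma bell_max_size Phi n :
  bell (fun s => Phi s *+ (size s == n)) n = Phi (nseq n 0%N).
Proof.
elim: n Phi => [|n IH] Phi //=.
rewrite -(IH (fun s => Phi (0%N :: s))); apply: eq_bell => s sn.
rewrite /bell_step big1 ?addr0 // => i _.
by rewrite size_incr_nth ltn_ord ltn_eqF // ltnS -sn leq_addl.
Qed.

Lemma bell_size Phi n :
  bell Phi n = \sum_(r < n.+1) bell (fun s => Phi s *+ (size s == r)) n.
Proof.
rewrite -bell_sum; apply: eq_bell => s sn.
have sz : (size s < n.+1)%N by rewrite ltnS -sn leq_addl.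
rewrite (bigD1 (Ordinal sz)) //= eqxx big1 ?addr0 // => i.
by rewrite -val_eqE /= eq_sym => /negPf ->.
Qed.

End Bell.

Arguments bell {V}.

Lemma morph_bell (V W : zmodType) (f : V -> W) Phi n :
  {morph f : u v / u + v} -> f (bell Phi n) = bell (fun s => f (Phi s)) n.
Proof.
move=> fD; have f0 : f 0 = 0 by apply: (addrI (f 0)); rewrite -fD !addr0.
elim: n Phi => //= n IH Phi; rewrite IH; apply: eq_bell => s _.
by rewrite /bell_step fD (big_morph f fD f0).
Qed.

Section BellAction.
Variables (V : zmodType) (T : nat -> V -> V).

(** The coefficients of the solution W of W' = W T, W(0) = 1, applied to [v]. *)
Definition bell_act n v := bell (foldr T v) n.

Lemma bell_actS n v :
  bell_act n.+1 v = bconv (fun i k => bell_act i (T k v)) n.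
Proof.
rewrite /bell_act bellS; apply: eq_bconv => i k _; apply: eq_bell => s _.
by rewrite foldr_rcons.
Qed.

Hypothesis TD : forall k, {morph T k : u v / u + v}.

Lemma bell_actD n : {morph bell_act n : u v / u + v}.
Proof.
move=> u v; rewrite /bell_act -bellD; apply: eq_bell => s _.
by elim: s => //= k s ->; rewrite TD.
Qed.

Lemma bell_act0 n : bell_act n 0 = 0.
Proof. by apply: (addrI (bell_act n 0)); rewrite -bell_actD !addr0. Qed.

Lemma bell_act_bconv n F m :
  bell_act n (bconv F m) = bconv (fun i j => bell_act n (F i j)) m.
Proof. by apply: morph_bconv; exact: bell_actD. Qed.

End BellAction.

Arguments bell_act {V}.

Lemma bracketDr (A : pzRingType) (a : A) : {morph commr a : u v / u + v}.
Proof. by move=> u v; rewrite /commr mulrDr mulrDl opprD addrACA. Qed.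

Lemma bracketM (A : pzRingType) (a u v : A) :
  commr a (u * v) = commr a u * v + u * commr a v.
Proof. by rewrite /commr mulrBl mulrBr !mulrA addrA subrK. Qed.

(** * Products, adjoint actions and nested brackets as Bell sums *)

Section BellProducts.
Variables (A : pzRingType) (b : nat -> A).

Definition bell_prod n := bell (fun s => \prod_(k <- s) b k) n.
Definition bell_ad := bell_act (fun k => commr (b k)).
Definition bell_nested n := bell (fun s => nested_commr [seq b k | k <- s]) n.

Lemma bell_prodS n : bell_prod n.+1 = bconv (fun i k => bell_prod i * b k) n.
Proof.
rewrite /bell_prod bellS; apply: eq_bconv => i k _.
rewrite (@morph_bell _ _ (fun u => u * b k)) => [|u v]; last exact: mulrDl.
by apply: eq_bell => s _; rewrite big_rcons.
Qed.

Lemma nested_commr_rcons (s : seq A) a :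
  nested_commr (rcons s a) = foldr (@commr A) a s.
Proof. by elim: s => // u s IH; rewrite [RHS]/= -IH; case: s {IH}. Qed.

Lemma bell_nestedS n : bell_nested n.+1 = bconv (fun i k => bell_ad i (b k)) n.
Proof.
rewrite /bell_nested bellS; apply: eq_bconv => i k _; apply: eq_bell => s _.
by rewrite map_rcons nested_commr_rcons foldr_map.
Qed.

(** P is conjugation by B, written without inverses as P(u) B = B u. Differentiating the left side
    gives P([b, u]) B + P(u) B b, which by induction is B [b, u] + B u b = B b u. *)
Lemma bell_ad_prod n u :
  bconv (fun i j => bell_ad i u * bell_prod j) n = bell_prod n * u.
Proof.
elim/ltn_ind: n u => -[_ u|n IH u].
  by rewrite /= /bell_ad /bell_act /bell_prod /= !big_nil mul1r mulr1.
rewrite [LHS]/=.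
under eq_bconv => i j _ do rewrite [bell_ad _ _]bell_actS mulr_bconvl.
under [X in _ + X]eq_bconv => i j _ do rewrite bell_prodS mulr_bconvr.
rewrite bconvAC bconvA -bconvD bell_prodS mulr_bconvl.
apply: eq_bconv => i k ik.
have lt_in : (i < n.+1)%N by rewrite ltnS -ik leq_addr.
rewrite (IH i lt_in); under eq_bconv => a c _ do rewrite mulrA.
by rewrite -mulr_bconvl (IH i lt_in) /commr mulrBr !mulrA subrK.
Qed.

Variable E : A -> A.
Hypotheses (ED : {morph E : u v / u + v})
  (EM : forall u v, E (u * v) = E u * v + u * E v)
  (Eb : forall k, E (b k) = b k).

(* The convolution form of E(B) = N B. *)
Lemma bell_nested_prod n :
  bconv (fun i j => bell_nested i * bell_prod j) n = E (bell_prod n).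
Proof.
elim/ltn_ind: n => -[_|n IH].
  rewrite /= /bell_nested /bell_prod /= big_nil mul0r.
  have E11 := EM 1 1; rewrite !mulr1 mul1r in E11.
  by apply: (addrI (E 1)); rewrite -E11 addr0.
rewrite [LHS]/=.
under eq_bconv => i j _ do rewrite bell_nestedS mulr_bconvl.
under [X in _ + X]eq_bconv => i j _ do rewrite bell_prodS mulr_bconvr.
rewrite bconvAC bconvA -bconvD bell_prodS (morph_bconv _ _ _ _ _ ED).
apply: eq_bconv => i k ik.
have lt_in : (i < n.+1)%N by rewrite ltnS -ik leq_addr.
(* The derivative of N B is P(b) B + N B b, with P(b) B = B b by [bell_ad_prod]; this matches E(B b)
   = E(B) b + B b. *)
rewrite bell_ad_prod EM Eb addrC -(IH i lt_in) mulr_bconvl; congr (_ + _).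
by apply: eq_bconv => a c _; rewrite mulrA.
Qed.

Variable p : nat.
Hypotheses (p_pr : prime p) (pA : forall u : A, u *+ p = 0).

Lemma bell_ad_prime u : bell_ad p u = commr (bell_prod p) u.
Proof.
have := bell_ad_prod p u; rewrite bconv_prime //.
rewrite {1}/bell_ad {1}/bell_act /= {2}/bell_prod /= big_nil mulr1 /commr => <-.
by rewrite addrC addKr.
Qed.

Lemma bell_nested_prime : bell_nested p = E (bell_prod p).
Proof.
rewrite -bell_nested_prod bconv_prime // {1}/bell_nested /= mul0r add0r.
by rewrite {1}/bell_prod /= big_nil mulr1.
Qed.

End BellProducts.

(** * Separating lengths, and the expansion over compositions *)

Section PolynomialGrading.
Variables (A : nzRingType) (b : nat -> A).

(** Marking each letter with the central variable turns word length into degree, so the derivation E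
    exists on [{poly A}] even if [A] carries none. *)
Let bX k : {poly A} := (b k)%:P * 'X.

Lemma prod_polyCX s :
  \prod_(k <- s) bX k = (\prod_(k <- s) b k)%:P * 'X^(size s).
Proof.
elim: s => [|k s IH] /=; first by rewrite !big_nil mulr1.
rewrite !big_cons IH /bX polyCM exprS !mulrA; congr (_ * _).
by rewrite -!mulrA; congr (_ * _); rewrite commr_polyX.
Qed.

Lemma nested_commr_polyCX s :
  nested_commr [seq bX k | k <- s] =
  (nested_commr [seq b k | k <- s])%:P * 'X^(size s).
Proof.
elim: s => [|k [|l s] IH]; first by rewrite /= mul0r.
  by rewrite /= expr1.
rewrite -[LHS]/(commr (bX k) (nested_commr [seq bX k | k <- l :: s])) IH.
rewrite -[nested_commr (map b [:: k, l & s])]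
  /(commr (b k) (nested_commr [seq b k | k <- l :: s])).
rewrite -[size [:: k, l & s]]/(size (l :: s)).+1.
move: (nested_commr _) (size (l :: s)) => a n.
rewrite /commr polyCB !polyCM mulrBl /bX.
congr (_ - _).
  rewrite exprS -!mulrA; congr (_ * _); rewrite !mulrA; congr (_ * _).
  by rewrite commr_polyX.
rewrite exprSr -!mulrA; congr (_ * _); rewrite !mulrA; congr (_ * _).
by rewrite commr_polyXn.
Qed.

Lemma coefCMXn (a : A) n r : (a%:P * 'X^n)`_r = a *+ (n == r).
Proof. by rewrite coefCM coefXn eq_sym mulr_natr. Qed.

(* The derivation 'X d/d'X multiplies a word by its length. *)
Lemma bell_nested_size p r : prime p -> (forall u : A, u *+ p = 0) ->
  bell (fun s => nested_commr [seq b k | k <- s] *+ (size s == r)) p =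
  bell (fun s => (\prod_(k <- s) b k) *+ (size s == r)) p *+ r.
Proof.
move=> p_pr pA.
have pP (q : {poly A}) : q *+ p = 0.
  by apply/polyP => i; rewrite coefMn pA coef0.
pose E (q : {poly A}) := 'X * q^`().
have ED : {morph E : u v / u + v} by move=> u v; rewrite /E derivD mulrDr.
have EM u v : E (u * v) = E u * v + u * E v.
  by rewrite /E derivM mulrDr !mulrA (commr_polyX u).
have Eb k : E (bX k) = bX k.
  by rewrite /E /bX derivM derivC derivX mul0r add0r mulr1 commr_polyX.
have coefD i : {morph (fun q : {poly A} => q`_i) : u v / u + v}.
  by move=> u v; exact: coefD.
have /(congr1 (fun q : {poly A} => q`_r)) :=
  bell_nested_prime _ bX E ED EM Eb p p_pr pP.
rewrite /bell_nested (morph_bell _ _ _ _ _ (coefD r)).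
under eq_bell => s _ do rewrite nested_commr_polyCX coefCMXn.
move=> ->; rewrite /E coefXM; case: r => [|r] /=; first by rewrite mulr0n.
rewrite coef_deriv /bell_prod (morph_bell _ _ _ _ _ (coefD _)).
by congr (_ *+ _); apply: eq_bell => s _; rewrite prod_polyCX coefCMXn.
Qed.

End PolynomialGrading.

Lemma bell_prod_prime (K : fieldType) (A : algType K) (b : nat -> A) p :
  p \in [pchar K] ->
  bell_prod A b p = b 0 ^+ p +
    \sum_(1 <= r < p) r%:R^-1 *:
      bell (fun s => nested_commr [seq b k | k <- s] *+ (size s == r)) p.
Proof.
move=> charKp; have /andP[p_pr /eqP p0] := charKp; have p_gt0 := prime_gt0 p_pr.
have pA (u : A) : u *+ p = 0 by rewrite -scaler_nat p0 scale0r.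
rewrite /bell_prod bell_size big_ord_recr /= bell_max_size addrC.
rewrite /= big_nseq iter_mulr_1; congr (_ + _).
rewrite -(big_mkord xpredT (fun r => 
  bell (fun s => (\prod_(k <- s) b k) *+ (size s == r)) p)).
(* The term of length 0 vanishes: since p > 0, [bellS] exhibits a last part in every sequence. *)
rewrite big_ltn // -{1}(prednK p_gt0) bellS /=.
under eq_bconv => i k _ do under eq_bell => s _ do rewrite size_rcons /= mulr0n.
under eq_bconv => i k _ do rewrite bell0.
rewrite bconv0 add0r; apply: eq_big_nat => r /andP[r_gt0 lt_rp].
rewrite bell_nested_size // -scaler_nat scalerA mulVf ?scale1r //.
apply/negP => /eqP r0; move: lt_rp; rewrite ltnNge => /negP[].
by apply: dvdn_leq => //; rewrite (dvdn_pcharf charKp) r0.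
Qed.

(** * From Bell sums to sums over compositions *)

Lemma is_composition_rcons n s j :
  is_composition n (rcons s j) =
  [&& (0 < j)%N, (j <= n)%N & is_composition (n - j) s].
Proof.
rewrite /is_composition mem_rcons in_cons negb_or eq_sym -lt0n sumn_rcons.
case: (0 < j)%N => //=; case: (0%N \notin s) => /=; last by rewrite andbF.
by case: leqP => le_jn /=; [rewrite -[RHS](eqn_add2r j) subnK|
  apply/negbTE; rewrite gtn_eqF // (leq_trans le_jn) // leq_addl].
Qed.

Lemma comp_coef_rcons s j :
  comp_coef (rcons s j) = (comp_coef s * 'C(sumn s + j - 1, j - 1))%N.
Proof.
rewrite /comp_coef size_rcons big_ord_recr /=; congr (_ * _)%N; last first.
  by rewrite take_oversize ?size_rcons // sumn_rcons nth_rcons ltnn eqxx.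
apply: eq_bigr => i _; rewrite nth_rcons ltn_ord.
by rewrite -cats1 takel_cat.
Qed.

Lemma big_tuple_rcons (V : nmodType) (I : finType) r (P : pred (seq I))
    (F : seq I -> V) :
  \sum_(a : r.+1.-tuple I | P a) F a =
  \sum_(j : I) \sum_(a : r.-tuple I | P (rcons a j)) F (rcons a j).
Proof.
rewrite (pair_big_dep xpredT (fun j (a : r.-tuple I) => P (rcons a j))) /=.
rewrite (reindex (fun u : I * r.-tuple I => [tuple of rcons u.2 u.1])) //=.
exists (fun a : r.+1.-tuple I =>
  (last (thead a) (behead a), [tuple of belast (thead a) (behead a)])).
  case=> j a _ /=; congr pair; last apply: val_inj => /=.
    by case: a => -[|c a] sa //=; rewrite /thead (tnth_nth c) /= last_rcons.
  case: a => -[|c a] sa //=; rewrite /thead (tnth_nth c) /=.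
  by rewrite belast_rcons.
move=> a _; apply: val_inj => /=; case/tupleP: a => c a /=.
by rewrite theadE -lastI.
Qed.

(** Induction on the length, removing the last part. The bound [m] is separate from [n] so that the
    alphabet of the tuples stays fixed while [n] decreases. *)
Lemma bell_compositions (V : zmodType) (Phi : seq nat -> V) n m r :
  (n <= m)%N ->
  bell (fun s => Phi s *+ (size s == r)) n =
  \sum_(a : r.-tuple 'I_m.+1 | is_composition n (parts a))
    Phi [seq j.-1 | j <- parts a] *+ comp_coef (parts a).
Proof.
elim: r n Phi => [|r IH] n Phi le_nm.
  rewrite big_mkcond (big_pred1 [tuple]) => [|a]; last first.
    by apply/esym/eqP; exact: tuple0.
  rewrite /parts /= /is_composition /= /comp_coef big_ord0 mulr1n.
  case: n le_nm => [|n] _ //; rewrite -[RHS](bell0 _ n.+1).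
  apply: eq_bell => s sn.
  by case: s sn => //= j s _; rewrite mulr0n.
case: n le_nm => [|n] lt_nm.
  rewrite /= mulr0n big1 // => a; case/tupleP: a => j a.
  rewrite /is_composition /parts /= in_cons negb_or eq_sym addn_eq0.
  by case: (nat_of_ord j == 0%N); rewrite ?andbF.
rewrite bellS bconvC bconvE.
rewrite (big_tuple_rcons _ _ _
  (fun a => is_composition n.+1 [seq val i | i <- a])
  (fun a => Phi [seq j.-1 | j <- [seq val i | i <- a]] *+
    comp_coef [seq val i | i <- a])).
rewrite [RHS]big_ord_recl [X in _ = X + _]big1 ?add0r => [|a]; last first.
  by rewrite map_rcons is_composition_rcons.
pose G k := \sum_(a : r.-tuple 'I_m.+1 | is_composition (n - k) (parts a))
  Phi (rcons [seq j.-1 | j <- parts a] k) *+ comp_coef (parts a) *+ 'C(n, k).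
transitivity (\sum_(k < n.+1) G k).
  apply: eq_bigr => k _; rewrite /G sumrMnl; congr (_ *+ _).
  rewrite -(IH _ (fun s => Phi (rcons s k))).
    by apply: eq_bell => s _; rewrite size_rcons eqSS.
  by rewrite (leq_trans (leq_subr _ _)) // ltnW.
(* Last parts k + 1 with k > n belong to no composition of n + 1, so both sides are summed over k <
   m with zeros beyond n. *)
rewrite (big_ord_widen m G) // big_mkcond; apply: eq_bigr => k _ /=.
under eq_bigl => a do
  rewrite map_rcons is_composition_rcons -[val (lift _ _)]/k.+1 subSS ltnS.
rewrite ltnS; case: (leqP k n) => le_kn /=; last by rewrite big_pred0_eq.
apply: eq_bigr => a /andP[_ /eqP sa].
rewrite !map_rcons comp_coef_rcons -[val (lift _ _)]/k.+1 !subn1 addnS /=.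
by rewrite -/(parts a) sa subnK // mulrnA.
Qed.

(** * Powers of a primitive element *)

Section TwistedProduct.
Variables (A : pzRingType) (s : nat -> A) (D : nat -> A -> A).
Hypotheses (DD : forall k, {morph D k : u v / u + v})
  (DM : forall k u v, D k (u * v) = D k u * v + u * D k v)
  (sS : forall n, s n.+1 = - bconv (fun i j => D i (s j)) n).

Let P := bell_act D.
Let T k v := s k * v + D k v.

(** P' = P D with every [D k] a derivation, so P is multiplicative, like the exponential of a
    derivation. *)
Lemma bell_act_mul n u v : P n (u * v) = bconv (fun i j => P i u * P j v) n.
Proof.
elim/ltn_ind: n u v => -[_|n IH] u v; first by [].
rewrite [RHS]/= {1}/P bell_actS.
under [in RHS]eq_bconv => i j _ do rewrite /P bell_actS mulr_bconvl -/P.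
under [X in _ = _ + X]eq_bconv => i j _ do rewrite /P bell_actS mulr_bconvr -/P.
rewrite bconvAC bconvA -bconvD; apply: eq_bconv => i k ik.
have lt_in : (i < n.+1)%N by rewrite ltnS -ik leq_addr.
by rewrite DM bell_actD // -/P !IH.
Qed.

(** P(s) is constant: its derivative is P(D s) + P(s'), and s' = -D s. *)
Lemma bell_act_solution n :
  bconv (fun i j => P i (s j)) n = if n is 0%N then s 0 else 0.
Proof.
case: n => // n; rewrite [LHS]/=.
under eq_bconv => i j _ do rewrite /P bell_actS.
rewrite -bconvA -bconvD -[RHS](bconv0 _ n); apply: eq_bconv => i j _.
by rewrite -bell_act_bconv // -/P sS -bell_actD // addrN bell_act0.
Qed.

Lemma bell_act_intertwine n v :
  bconv (fun i j => P i (s j * v)) n = s 0 * P n v.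
Proof.
under eq_bconv => i j _ do rewrite bell_act_mul.
rewrite bconvAC.
under eq_bconv => i j _ do rewrite -mulr_bconvl bell_act_solution.
by rewrite bconv_left // => i j; rewrite mul0r.
Qed.

(** With s_0 = [s 0], the derivative of e^(t s_0) P(v) is e^(t s_0) (s_0 P(v) + P(D v)), and s_0
    P(v) = P(s v) by [bell_act_intertwine]; so e^(t s_0) P solves W' = W (s + D). *)
Lemma bell_act_twisted n v :
  bell_act T n v = bconv (fun i j => s 0 ^+ i * P j v) n.
Proof.
elim/ltn_ind: n v => -[_|n IH] v; first exact/esym/mul1r.
transitivity (bconv (fun m k => bconv (fun i j => s 0 ^+ i * P j (T k v)) m) n).
  rewrite bell_actS; apply: eq_bconv => i k ik.
  by rewrite IH // ltnS -ik leq_addr.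
rewrite -bconvA [RHS]/= -bconvD; apply: eq_bconv => i m _.
rewrite -mulr_bconvr exprSr -mulrA -mulrDr; congr (_ * _).
rewrite -bell_act_intertwine [X in _ + X]bell_actS -bconvD.
by apply: eq_bconv => j k _; rewrite [LHS]bell_actD.
Qed.

Lemma bell_act_twisted1 n : (forall k, D k 1 = 0) -> bell_act T n 1 = s 0 ^+ n.
Proof.
move=> D1; rewrite bell_act_twisted bconv_right ?mulr1 // => i j.
rewrite /P bell_actS; under eq_bconv => a c _ do rewrite D1 bell_act0 //.
by rewrite bconv0 mulr0.
Qed.

End TwistedProduct.

(** * Commutators and p-th powers *)

Section CommrTheory.
Variables (K : fieldType) (A : algType K).
Implicit Types u v w : A.

Lemma bracketC u v : commr u v = - commr v u.
Proof. by rewrite /commr opprB. Qed.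

Lemma bracketDl u v w : commr (u + v) w = commr u w + commr v w.
Proof. by rewrite bracketC bracketDr opprD -!bracketC. Qed.

Lemma bracketZr (c : K) u v : commr u (c *: v) = c *: commr u v.
Proof. by rewrite /commr scalerBr -scalerAl -scalerAr. Qed.

Lemma bracketZl (c : K) u v : commr (c *: u) v = c *: commr u v.
Proof. by rewrite [LHS]bracketC bracketZr -scalerN -bracketC. Qed.

(** The bracket with [u] is left multiplication by u plus right multiplication by -u; these commute,
    so the binomial theorem applies. *)
Lemma iter_commr n u v :
  iter n (commr u) v = bconv (fun i j => u ^+ i * v * (- u) ^+ j) n.
Proof.
elim: n => [|n IH]; first by rewrite /= mul1r mulr1.
rewrite iterS IH (morph_bconv _ _ _ _ _ (@bracketDr _ u)) [RHS]/= -bconvD.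
by apply: eq_bconv => i j _; rewrite /commr exprS exprSr !mulrA mulrN.
Qed.

Lemma commr_exp_prime p u v : p \in [pchar K] ->
  commr (u ^+ p) v = iter p (commr u) v.
Proof.
move=> charKp; have charAp : p \in [pchar A] by rewrite pchar_lalg.
have /andP[p_pr /eqP p0] := charKp.
rewrite iter_commr bconv_prime // => [|w]; last first.
  by rewrite -scaler_nat p0 scale0r.
rewrite mul1r mulr1 -[(- u) ^+ p](pFrobenius_autE charAp) pFrobenius_autN.
by rewrite pFrobenius_autE mulrN addrC.
Qed.

Lemma nested_commr_scale (b : nat -> A) (c : nat -> K) (s : seq nat) :
  nested_commr [seq c k *: b k | k <- s] =
  (\prod_(k <- s) c k) *: nested_commr [seq b k | k <- s].
Proof.
elim: s => [|k [|l s] IH]; first by rewrite /= scaler0.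
  by rewrite /= big_seq1.
rewrite big_cons -scalerA.
rewrite -[LHS]/(commr (c k *: b k) (nested_commr [seq c k *: b k | k <- l :: s])).
by rewrite IH bracketZl bracketZr.
Qed.

End CommrTheory.

Lemma sumn_predn (s : seq nat) : 0%N \notin s ->
  sumn [seq j.-1 | j <- s] = (sumn s - size s)%N.
Proof.
elim: s => //= j s IH; rewrite in_cons negb_or => /andP[j_neq0 s0].
have le_s : (size s <= sumn s)%N.
  elim: s s0 {IH} => //= i s IH; rewrite in_cons negb_or => /andP[i0 s0].
  by rewrite -add1n leq_add ?IH // lt0n eq_sym.
by case: j j_neq0 => // j _; rewrite IH // addSn subSS addnBA.
Qed.

Section PowersOfPrimitive.
Variables (K : fieldType) (p : nat) (charKp : p \in [pchar K]).
Variables (A : algType K) (R : {linear A -> A}).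

(* The form taken by R(u)R(v) = R(u_1 R(u_2) v S(R(u_3))) when u is primitive. *)
Definition rb_primitive (u : A) :=
  forall v, R u * R v = R (u * v + commr (R u) v).

Lemma rb_primitiveD u v :
  rb_primitive u -> rb_primitive v -> rb_primitive (u + v).
Proof.
move=> Qu Qv w; rewrite (linearD R u v) !mulrDl bracketDl Qu Qv addrACA.
by rewrite [RHS]linearD.
Qed.

Lemma rb_primitiveZ c u : rb_primitive u -> rb_primitive (c *: u).
Proof.
move=> Qu w; rewrite (linearZ_LR R c u) -!scalerAl bracketZl Qu -scalerDr.
by rewrite [RHS]linearZ.
Qed.

Variable x : A.
Let y k := bpow (rb_tri R) x k.+1.
Hypotheses (R1 : R 1 = 1) (Qy : forall k, rb_primitive (y k)).

Let s k := (-1) ^+ k *: y k.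
Let b k := R (s k).
Let D k := commr (b k).

Lemma signed_bpowS n : s n.+1 = - bconv (fun i j => D i (s j)) n.
Proof.
rewrite /s /y bpow_rec // big_add1 big_mkord bconvE /= scaler_sumr -sumrN.
apply: eq_bigr => i _.
rewrite /D /b /s /y linearZ bracketZl bracketZr scalerA -exprD.
have le_in : (i <= n)%N by rewrite -ltnS.
rewrite subnKC // subSS subSn // subn1 !subSS subn0 /= exprS mulN1r scaleNr.
by rewrite scalerMnr.
Qed.

Let D_add k : {morph D k : u v / u + v}. Proof. exact: bracketDr. Qed.
Let D_mul k u v : D k (u * v) = D k u * v + u * D k v.
Proof. exact: bracketM. Qed.

Let T k v := s k * v + D k v.

(** Since each [s k] is [rb_primitive], R turns an application of [T k] into left multiplication by
    [b k]. *)
Lemma R_bell_act n v : R (bell_act T n v) = bell_prod A b n * R v.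
Proof.
rewrite /bell_prod (@morph_bell _ _ (fun u => u * R v)) => [|u w]; last first.
  exact: mulrDl.
rewrite /bell_act (@morph_bell _ _ R) => [|u w]; last exact: raddfD.
apply: eq_bell => t _; elim: t => [|k t IH]; first by rewrite /= big_nil mul1r.
rewrite big_cons -mulrA -IH /= /b; apply/esym; exact/rb_primitiveZ.
Qed.

Lemma R_exp n : R (x ^+ n) = bell_prod A b n.
Proof.
rewrite -[RHS]mulr1 -R1 -R_bell_act /T.
rewrite (@bell_act_twisted1 _ s D D_add D_mul signed_bpowS).
  by rewrite /s expr0 scale1r.
by move=> k; rewrite /D /commr mulr1 mul1r subrr.
Qed.

Lemma rb_primitive_exp : rb_primitive (x ^+ p).
Proof.
have /andP[p_pr /eqP p0] := charKp.
have pA (u : A) : u *+ p = 0 by rewrite -scaler_nat p0 scale0r.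
move=> v; rewrite R_exp -R_bell_act /T.
rewrite (@bell_act_twisted _ s D D_add D_mul signed_bpowS) bconv_prime //.
rewrite [bell_act D p v](bell_ad_prime _ b p p_pr pA) mul1r addrC.
by rewrite /s expr0 scale1r.
Qed.

Lemma R_exp_prime :
  R (x ^+ p) =
    R x ^+ p +
    \sum_(1 <= r < p) ((-1) ^+ (p - r) * (r%:R)^-1) *:
      \sum_(a : r.-tuple 'I_p.+1 | is_composition p (parts a))
        nested_commr [seq R (bpow (rb_tri R) x j) | j <- parts a]
          *+ comp_coef (parts a).
Proof.
rewrite R_exp (bell_prod_prime _ _ _ _ charKp) {1}/b {1}/s expr0 scale1r.
congr (_ + _); apply: eq_big_nat => r _.
rewrite mulrC -scalerA; congr (_ *: _).
rewrite (bell_compositions _ (fun t => nested_commr [seq b k | k <- t]) _ p) //.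
rewrite scaler_sumr; apply: eq_bigr => a /andP[a0 /eqP sa].
rewrite -scalerMnr; congr (_ *+ _).
have -> : [seq b k | k <- [seq j.-1 | j <- parts a]] =
   [seq (-1) ^+ k *: R (y k) | k <- [seq j.-1 | j <- parts a]].
  by apply: eq_map => k; rewrite /b /s linearZ.
rewrite nested_commr_scale -map_comp.
have sz : size (parts a) = r by rewrite size_map size_tuple.
move: (parts a) a0 sa sz => t t0 st sz; congr (_ *: nested_commr _).
  (* The signs (-1)^(j-1) over the r parts of a composition of p multiply to (-1)^(p-r). *)
  by rewrite -expr_sum -sumnE sumn_predn // st sz.
apply/eq_in_map => j jt; rewrite /= /y prednK // lt0n.
by apply: contraNneq t0 => <-.
Qed.

End PowersOfPrimitive.

(** * The span of the p-power iterates *)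

Section PowerClosure.
Variables (K : fieldType) (p : nat) (charKp : p \in [pchar K]).
Variables (g : lieAlgType K) (R : {linear g -> g}) (U : algType K)
  (iota : {linear g -> U}) (iota_lie : lie_to_assoc iota)
  (Rhat : {linear U -> U}) (Rhat_ext : is_RB_extension iota R Rhat).

Let in_g (u : U) := exists a, u = iota a.

(* Closing under all p-th powers, and not only those of elements of g, makes
   R(x)^p a member without Jacobson's formula. *)
Inductive p_closure : U -> Prop :=
| p_closure_iota a : p_closure (iota a)
| p_closureD u v : p_closure u -> p_closure v -> p_closure (u + v)
| p_closureZ c u : p_closure u -> p_closure (c *: u)
| p_closure_exp u : p_closure u -> p_closure (u ^+ p).

Lemma in_p_closure_sub u : in_p_closure iota p u -> p_closure u.
Proof.
case=> n [c [a [e ->]]]; apply: big_ind => [||i _].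
- by rewrite -(linear0 iota); exact: p_closure_iota.
- exact: p_closureD.
apply: p_closureZ; elim: (e i) => [|m IH]; first exact: p_closure_iota.
by rewrite expnSr exprM; exact: p_closure_exp.
Qed.

Let in_gD u v : in_g u -> in_g v -> in_g (u + v).
Proof. by move=> [a ->] [c ->]; exists (a + c); rewrite linearD. Qed.

Let in_gZ c u : in_g u -> in_g (c *: u).
Proof. by move=> [a ->]; exists (c *: a); rewrite linearZ. Qed.

Let in_gN u : in_g u -> in_g (- u).
Proof. by rewrite -scaleN1r; exact: in_gZ. Qed.

Let in_g_p_closure u : in_g u -> p_closure u.
Proof. by case=> a ->; exact: p_closure_iota. Qed.

Lemma p_closure_commr_iota u v : p_closure u -> in_g v -> in_g (commr u v).
Proof.
move=> pu; elim: pu v => {u}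
  [a _ [c ->]|u w _ IHu _ IHw v gv|c u _ IH v gv|u _ IH v gv].
- by exists (lie a c); rewrite iota_lie.
- by rewrite bracketDl; apply: in_gD; [exact: IHu | exact: IHw].
- by rewrite bracketZl; apply: in_gZ; exact: IH.
- by rewrite commr_exp_prime //; elim: (p in iter p) => //= n; exact: IH.
Qed.

(** Brackets fall back into the image of g itself, because ad(v^p) = ad(v)^p reduces a bracket with
    a p-th power to iterated brackets. *)
Lemma p_closure_commr u v : p_closure u -> p_closure v -> in_g (commr u v).
Proof.
move=> pu; elim=> {v} [a|v w _ IHv _ IHw|c v _ IH|v pv IH].
- by apply: p_closure_commr_iota => //; exists a.
- by rewrite bracketDr; exact: in_gD.
- by rewrite bracketZr; exact: in_gZ.
rewrite bracketC commr_exp_prime //; apply: in_gN.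
(* The innermost bracket [v, u] lies in the image of g by induction; the other p - 1 brackets
   preserve that image. *)
have /andP[p_pr _] := charKp; rewrite -(prednK (prime_gt0 p_pr)) iterSr.
elim: p.-1 => [|n IHn] /=; first by rewrite bracketC; exact: in_gN.
exact: p_closure_commr_iota.
Qed.

Lemma p_closure_nested s : (forall u, u \in s -> p_closure u) ->
  p_closure (nested_commr s).
Proof.
elim: s => [_|u [|w s] IH ps].
- by rewrite /= -(linear0 iota); exact: p_closure_iota.
- by apply: ps; rewrite mem_head.
apply/in_g_p_closure/p_closure_commr; first by apply: ps; rewrite mem_head.
by apply: IH => v vs; apply: ps; rewrite in_cons vs orbT.
Qed.

Let Rhat_in_g u : in_g u -> in_g (Rhat u).
Proof. by case: Rhat_ext => _ Ri _ [a ->]; exists (R a). Qed.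

Let rb_primitive_in_g u : in_g u -> rb_primitive _ _ Rhat u.
Proof.
by case: Rhat_ext => _ _ Ri [a ->] v; rewrite [RHS]linearD Ri subrK.
Qed.

(** From two factors on, each product is a bracket and lies in the image of g, where the equation
    defining [Rhat] is [rb_primitive]. Only [x] itself then needs a separate argument. *)
Lemma bpow_p_closure x k : p_closure x -> p_closure (Rhat x) ->
  in_g (bpow (rb_tri Rhat) x k.+2).
Proof.
move=> px pRx; elim/ltn_ind: k => k IH; rewrite bpow_rec //.
rewrite big_nat; apply: big_ind => [||i /andP[i_gt0 lt_ik]].
- by exists 0; rewrite linear0.
- exact: in_gD.
rewrite -scaler_nat; apply/in_gZ/p_closure_commr.
  case: i i_gt0 lt_ik => [//|[|i]] _ lt_ik; first by rewrite bpow1.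
  by apply/in_g_p_closure/Rhat_in_g/IH.
rewrite -subn_gt0 in lt_ik.
have: (k.+2 - i < k.+2)%N by rewrite ltn_subrL i_gt0.
case: (k.+2 - i)%N lt_ik => [//|[|j]] _ lt_jk; first by rewrite bpow1.
exact/in_g_p_closure/IH.
Qed.

Lemma rb_primitive_bpow x : p_closure x -> p_closure (Rhat x) ->
  rb_primitive _ _ Rhat x ->
  forall k, rb_primitive _ _ Rhat (bpow (rb_tri Rhat) x k.+1).
Proof.
move=> px pRx Qx [|k]; first by rewrite bpow1.
exact/rb_primitive_in_g/bpow_p_closure.
Qed.

(** The two claims need a joint induction: at u^p both use that all powers [bpow] of u are
    [rb_primitive], which rests on both claims for u. The formula [R_exp_prime] then shows that
    R(u^p) stays in the closure. *)
Lemma p_closure_rb_primitive x : p_closure x ->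
  p_closure (Rhat x) /\ rb_primitive _ _ Rhat x.
Proof.
elim=> {x} [a|u v _ [pu Qu] _ [pv Qv]|c u _ [pu Qu]|u pu [pRu Qu]].
- split; last by apply: rb_primitive_in_g; exists a.
  by apply/in_g_p_closure/Rhat_in_g; exists a.
- by split; [rewrite linearD; exact: p_closureD | exact: rb_primitiveD].
- by split; [rewrite linearZ; exact: p_closureZ | exact: rb_primitiveZ].
have [R1 _ _] := Rhat_ext; have Qy := rb_primitive_bpow _ pu pRu Qu.
split; last exact: (rb_primitive_exp _ _ charKp).
rewrite (R_exp_prime _ _ charKp _ _ _ R1 Qy); apply: p_closureD.
  exact: p_closure_exp.
have p0 : p_closure 0 by rewrite -(linear0 iota); exact: p_closure_iota.
apply: big_ind => // [|r _]; first exact: p_closureD.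
apply: p_closureZ; apply: big_ind => // [|a /andP[a0 _]].
  exact: p_closureD.
rewrite -scaler_nat; apply/p_closureZ/p_closure_nested => w /mapP[j ja ->].
case: j ja => [|[|j]] ja; first by rewrite ja in a0.
  by rewrite bpow1.
exact/in_g_p_closure/Rhat_in_g/bpow_p_closure.
Qed.

End PowerClosure.

Theorem proposition4p19 (k : closedFieldType) (p : nat) (charkp : p \in [pchar k])
    (g : lieAlgType k) (R : {linear g -> g}) (R_RB : rota_baxter1 R)
    (U : algType k) (iota : {linear g -> U})
    (U_univ : is_universal_enveloping iota)
    (Rhat : {linear U -> U}) (Rhat_ext : is_RB_extension iota R Rhat)
    (x : U) (gp_x : in_p_closure iota p x) :
  Rhat (x ^+ p) =
    Rhat x ^+ p +
    \sum_(1 <= r < p) ((-1) ^+ (p - r) * (r%:R)^-1) *: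
      \sum_(a : r.-tuple 'I_p.+1 | is_composition p (parts a))
        nested_commr [seq Rhat (bpow (rb_tri Rhat) x j) | j <- parts a]
          *+ comp_coef (parts a).
Proof.
have [iota_lie _] := U_univ; have px := in_p_closure_sub _ _ _ _ _ _ gp_x.
have [pRx Qx] :=
  p_closure_rb_primitive _ _ charkp _ _ _ _ iota_lie _ Rhat_ext _ px.
apply: (R_exp_prime _ _ charkp); first by case: Rhat_ext.
exact: (rb_primitive_bpow _ _ charkp _ _ _ _ iota_lie _ Rhat_ext).
Qed.
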